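(* Let $(\Delta,\mathcal D,\mathbb P)$ be a probability space, $\mathcal X\subseteq\mathbb R^d$, $f:\mathcal X\to\mathbb R$, $g:\mathcal X\to\mathbb R^q$, $b:\Delta\to\mathbb R^q$. Given $\bar\epsilon\in(0,1)$ and $\beta\in(0,1)$, the output $x^\star$ returned by the incremental scenario algorithm (described in the context, run with the sizes $N_0,N_1,\dots,N_q$ determined by $\bar\epsilon$, $\beta$ and $q$) satisfies $$\mathbb P^{N_q}\{V(x^\star)\le\bar\epsilon\}\ge 1-\beta,$$ for any probability $\mathbb P$.
   Context: Vector inequalities are componentwise; $g_\ell,b_\ell$ denote the $\ell$-th components of $g,b$, and $q\ge1$. No convexity of $\mathcal X$, $f$ or $g$ is assumed. The risk of $x\in\mathcal X$ is $V(x)=\mathbb P\{\delta\in\Delta:\ g(x)\not\le b(\delta)\}$. Standing assumption: for every $N$, the scenario problem $\min_{x\in\mathcal X}f(x)$ s.t. $g(x)\le b(\delta_i)$, $i=1,\dots,N$, with $\delta_1,\dots,\delta_N$ independent draws from $(\Delta,\mathcal D,\mathbb P)$, is feasible with probability one. $\mathbb P^{N_q}$ is the product probability on $\Delta^{N_q}$, the law of the i.i.d. scenarios $(\delta_1,\dots,\delta_{N_q})$. As is implicit in writing these probabilities, the sets involved are assumed measurable. Sizes $N_j$. For $j=1,\dots,q$, $$\bar M_j=\min\Big\{M\ge j:\ \sum_{m=0}^{j-1}\binom{M}{m}\bar\epsilon^m(1-\bar\epsilon)^{M-m}\le\beta\Big\},$$ and $\bar M_0=\bar M_1$. For $j=0,1,\dots,q$,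 put $\beta_j=\dfrac{\beta}{(q+1)(\bar M_j+1)}$ and $$N_j=\min\Big\{N>\bar M_j:\ \beta_j\sum_{m=j}^{\bar M_j}\binom{m}{j}(1-\bar\epsilon)^{m-j}\ \ge\ \binom{N}{j}(1-\bar\epsilon)^{N-j}\Big\}.$$ ($M$, $N$ range over integers.) Incremental scenario algorithm. Input: $N_0,\dots,N_q$. Output: $x^\star$. 1. Set $j\leftarrow 0$ and $N_{-1}\leftarrow 0$. 2. Collect i.i.d. data $\delta_{N_{j-1}+1},\dots,\delta_{N_j}$ from $(\Delta,\mathcal D,\mathbb P)$, independent of the previous scenarios. 3. Set $\mathcal I_{N_j}\leftarrow\{i_1,\dots,i_q\}$ with $i_\ell=\arg\min_{i=1,\dots,N_j}b_\ell(\delta_i)$ for $\ell=1,\dots,q$ (a unique index being selected via a tie-break rule, e.g. the smallest index, if the minimum is attained more than once). 4. Set $\varsigma_{N_j}\leftarrow$ the number of distinct indices in $\mathcal I_{N_j}$. 5. If $\varsigma_{N_j}\le j$, let $x^\star$ be a possibly sub-optimal solution (i.e. a feasible point, not necessarily a minimizer) of $$\min_{x\in\mathcal X}f(x)\quad\text{s.t. } g_\ell(x)\le b_\ell(\delta_{i_\ell}),\ \ell=1,\dots,q,$$ and return $x^\star$. Otherwise set $j\leftarrow j+1$ and go to step 2. The algorithm always terminates at some $j\le q$, since $\varsigma_{N_q}\le q$.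
   Formalization: The probability is taken under P^N with N = max of N_0,…,N_q in place of N_q; these agree when every N_j ≤ N_q, but for β very near 1 (e.g. ε̄=1/2, q=15, β=1−0.99·2^(−14): N_14=70 > N_15=69) x* may depend on more than N_q scenarios. The components of b are taken measurable. *)

(* Defs.v *)
From HB Require Import structures.
From mathcomp Require Import all_boot all_order all_algebra.
From mathcomp Require Import all_classical all_reals all_analysis.

Set Implicit Arguments.
Unset Strict Implicit.
Unset Printing Implicit Defensive.

Import Order.TTheory GRing.Theory Num.Theory.
Import numFieldNormedType.Exports.

Local Open Scope classical_set_scope.
Local Open Scope ring_scope.

(* The product probability P^N on N.-tuple T, by recursion on N: the law of
   x :: w for x ~ P and w ~ P^(N-1) independent. *)
Section power_probability.
Context (d : measure_display) (T : measurableType d) (R : realType).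

Definition tuple_cons (n : nat) (z : T * n.-tuple T) : n.+1.-tuple T :=
  [tuple of z.1 :: z.2].

Lemma measurable_tuple_cons (n : nat) :
  measurable_fun [set: T * n.-tuple T] (@tuple_cons n).
Proof. exact: measurable_cons. Qed.

HB.instance Definition _ (n : nat) :=
  isMeasurableFun.Build _ _ _ _ (@tuple_cons n) (@measurable_tuple_cons n).

Fixpoint power_probability (P : probability T R) (n : nat) :
    probability (n.-tuple T) R :=
  match n return probability (n.-tuple T) R with
  | 0 => \d_ ([tuple] : 0.-tuple T)
  | m.+1 => distribution (P \x power_probability P m)%E (@tuple_cons m)
  end.

Lemma power_probability_box (P : probability T R) (n : nat)
    (A : 'I_n -> set T) (mA : forall i, measurable (A i)) :
  power_probability P n [set w | forall i, A i (tnth w i)] =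
  (\prod_(i < n) P (A i))%E.
Proof.
elim: n A mA => [|n IH] A mA.
  rewrite big_ord0 /= diracE mem_set// => -[].
  by [].
rewrite big_ord_recl /= /distribution /pushforward /=.
rewrite (_ : _ @^-1` _ =
  A ord0 `*` [set w | forall i, A (lift ord0 i) (tnth w i)]); last first.
  apply/seteqP; split=> -[x w] /=.
    move=> Axw; split; first by have := Axw ord0; rewrite tnth0.
    by move=> i; have := Axw (lift ord0 i); rewrite tnthS.
  move=> [Ax Aw] i; have [j ->|->] := unliftP ord0 i.
    by rewrite tnthS.
  by rewrite tnth0.
rewrite product_measure1E//.
  congr (_ * _)%E.
  exact: (IH (fun i => A (lift ord0 i)) (fun i => mA (lift ord0 i))).
rewrite (_ : [set _ | _] = \bigcap_(i in [set: 'I_n])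
    ((fun w : n.-tuple T => tnth w i) @^-1` A (lift ord0 i))); last first.
  by apply/seteqP; split=> w /= h i; [move=> _; exact: h | exact: h].
apply: fin_bigcap_measurable => //= i _.
rewrite -[X in measurable X]setTI; exact: measurable_tnth.
Qed.

End power_probability.

(* The minimum of a nonempty set of naturals (0 on the empty set). *)
Definition least (A : set nat) : nat :=
  xget 0%N [set m | A m /\ forall k, A k -> (m <= k)%N].

Lemma leastP (A : set nat) : A !=set0 ->
  A (least A) /\ forall k, A k -> (least A <= k)%N.
Proof.
move=> [a /asboolP Aa].
have exA : exists m, `[< A m >] by exists a.
case: (ex_minnP exA) => m /asboolP Am mmin.
rewrite /least; case: xgetP => [x _ //|/(_ m)[]].
by split=> // k /asboolP; exact: mmin.
Qed.

(* Both minima below range over nonempty sets when 0 < eps < 1 and 0 < beta: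
   'C(M, m) * (1 - eps) ^+ M tends to 0 as M grows, and the left-hand side of
   the inequality defining [size_at] is positive because j <= Mbar j.
   [maxn j 1] encodes the convention Mbar 0 = Mbar 1. *)
Section sizes.
Context (R : realType) (eps beta : R) (q : nat).

Definition Mbar (j : nat) : nat :=
  let k := maxn j 1 in
  least [set M : nat | (k <= M)%N /\
    \sum_(0 <= m < k) 'C(M, m)%:R * eps ^+ m * (1 - eps) ^+ (M - m) <= beta].

Definition beta_at (j : nat) : R := beta / (q.+1%:R * (Mbar j).+1%:R).

Definition size_at (j : nat) : nat :=
  least [set N : nat | (Mbar j < N)%N /\
    'C(N, j)%:R * (1 - eps) ^+ (N - j) <=
    beta_at j * \sum_(j <= m < (Mbar j).+1) 'C(m, j)%:R * (1 - eps) ^+ (m - j)].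

(* The number of scenarios that a full run may consult. It is N_q whenever no
   N_j exceeds N_q ([num_scenariosE]). That is not automatic: eps = 1/2, q = 15
   and beta = 1 - 0.99 * 2^-14 give N_14 = 70 and N_15 = 69. *)
Definition num_scenarios : nat := \max_(j < q.+1) size_at j.

Lemma num_scenariosE :
  (forall j, (j <= q)%N -> (size_at j <= size_at q)%N) ->
  num_scenarios = size_at q.
Proof.
move=> h; apply/eqP; rewrite eqn_leq; apply/andP; split.
  by apply/bigmax_leqP => j _; apply: h; rewrite -ltnS.
exact: (@leq_bigmax _ (fun j : 'I_q.+1 => size_at j) ord_max).
Qed.

End sizes.

Record opt_problem (R : realType) (n : nat) := OptProblem {
  feasible : set 'rV[R]_n ;
  objective : 'rV[R]_n -> R }.

Section scenario.
Context (d : measure_display) (Delta : measurableType d) (R : realType).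
Context (n q : nat) (X : set 'rV[R]_n) (f : 'rV[R]_n -> R).
Context (g : 'rV[R]_n -> 'rV[R]_q) (b : Delta -> 'rV[R]_q).

Definition vec_le (u v : 'rV[R]_q) : bool := [forall l, u 0 l <= v 0 l].

Definition risk (P : probability Delta R) (x : 'rV[R]_n) : \bar R :=
  P [set delta | ~~ vec_le (g x) (b delta)].

Definition scenario_problem (s : seq Delta) : opt_problem R n :=
  OptProblem [set x | X x /\ all (fun delta => vec_le (g x) (b delta)) s] f.

Definition component_values (l : 'I_q) (s : seq Delta) : seq R :=
  [seq b delta 0 l | delta <- s].

(* [sel s l] is the (0-based) index i_l in the data s. Any way of choosing among
   the minimizers is allowed, the smallest index in particular. *)
Definition argmin_rule (sel : seq Delta -> 'I_q -> nat) : Prop :=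
  forall (s : seq Delta) (l : 'I_q), (0 < size s)%N ->
    (sel s l < size s)%N /\
    forall k, (k < size s)%N ->
      (component_values l s)`_(sel s l) <= (component_values l s)`_k.

Context (sel : seq Delta -> 'I_q -> nat).

Definition num_selected (s : seq Delta) : nat :=
  size (undup [seq sel s l | l <- enum 'I_q]).

Definition reduced_problem (s : seq Delta) : opt_problem R n :=
  OptProblem
    [set x | X x /\ forall l, g x 0 l <= (component_values l s)`_(sel s l)] f.

Context (N : nat -> nat) (w : seq Delta).

(* The first stage j whose data, the first N_j scenarios, have at most j distinct
   selected indices; the search succeeds since [num_selected] never exceeds q. *)
Definition stopping_stage : nat :=
  find (fun j => num_selected (take (N j) w) <= j)%N (iota 0 q.+1).

(* The problem of which the returned point is a possibly sub-optimal solution. *)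
Definition final_problem : opt_problem R n :=
  reduced_problem (take (N stopping_stage) w).

End scenario.

(* Main.v *)
(* Call a set I of indices a cover of a data set U if, in each component, the
   minimum of b over U is attained on I. When the algorithm stops at stage j,
   the first N_j data have a cover of at most j elements, and the risk of the
   returned point is at most the probability W(I) that a new scenario falls
   below the minimum over I in some component.
   Choose for every U one smallest cover, with a tie-break that does not depend
   on the data. If I is chosen for S and I is contained in U, which is contained
   in S, then I is chosen for U, and in addition the data in S \ U are dominated
   by I; given that I is chosen for U and W(I) > eps, the latter has conditional
   probability at most (1 - eps)^(#|S| - #|U|). Averaging over all U of size m,
   then summing over m <= Mbar_j, turns the inequality that defines N_j into the
   bound beta_j * (Mbar_j + 1) = beta / (q + 1) for a failure at stage j. *)
Require Import Defs.
From mathcomp Require Import all_boot all_order all_algebra.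
From mathcomp Require Import all_classical all_reals all_analysis.
From mathcomp Require Import measurable_realfun ring.

Set Implicit Arguments.
Unset Strict Implicit.
Unset Printing Implicit Defensive.

Import Order.TTheory GRing.Theory Num.Theory.

Local Open Scope classical_set_scope.
Local Open Scope ring_scope.

(** * Resampling one coordinate of a product law *)

Section resampling.
Context (disp : measure_display) (T : measurableType disp) (R : realType).

Definition replace (n : nat) (i : 'I_n) (w : n.-tuple T) (x : T) : n.-tuple T :=
  [tuple if k == i then x else tnth w k | k < n].

Lemma tnth_replace (n : nat) (i : 'I_n) (w : n.-tuple T) (x : T) (k : 'I_n) :
  tnth (replace i w x) k = if k == i then x else tnth w k.
Proof. by rewrite tnth_mktuple. Qed.

Lemma measurable_replace (n : nat) (i : 'I_n) :
  measurable_fun [set: n.-tuple T * T] (fun z => replace i z.1 z.2).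
Proof.
apply/measurable_fun_tnthP => k.
rewrite [X in measurable_fun _ X](_ : _ =
    fun z : n.-tuple T * T => if k == i then z.2 else tnth z.1 k); last first.
  by apply/funext => z; rewrite /= tnth_replace.
case: eqP => _; first exact: measurable_snd.
apply: (@measurableT_comp _ _ _ _ _ _ (fun t : n.-tuple T => tnth t k)) => //.
exact: measurable_tnth.
Qed.

Lemma replace_cons0 (n : nat) (y x : T) (w : n.-tuple T) :
  replace ord0 (tuple_cons (y, w)) x = tuple_cons (x, w).
Proof.
apply: eq_from_tnth => k; rewrite tnth_replace.
by have [j ->|->] := unliftP ord0 k; rewrite ?eqxx ?tnth0// !tnthS.
Qed.

Lemma replace_consS (n : nat) (i : 'I_n) (y x : T) (w : n.-tuple T) :
  replace (lift ord0 i) (tuple_cons (y, w)) x = tuple_cons (y, replace i w x).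
Proof.
apply: eq_from_tnth => k; rewrite tnth_replace.
have [j ->|->] := unliftP ord0 k; last by rewrite !tnth0.
by rewrite (inj_eq lift_inj) !tnthS tnth_replace.
Qed.

Context (P : probability T R).
Local Open Scope ereal_scope.

Lemma integral_power_probabilityS (n : nat) (f : n.+1.-tuple T -> \bar R) :
  measurable_fun [set: _.-tuple T] f -> (forall w, 0 <= f w) ->
  \int[power_probability P n.+1]_w f w =
  \int[P]_y \int[power_probability P n]_w f (tuple_cons (y, w)).
Proof.
move=> mf f0; rewrite [LHS]ge0_integral_distribution//.
rewrite (fubini_tonelli1 (f \o @tuple_cons _ T n))//; last first.
  by move=> z; exact: f0.
exact: (measurableT_comp mf (@measurable_tuple_cons _ T n)).
Qed.

(** Induction on [n]. For a coordinate of the tail, the head is fixed and the induction hypothesis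
    applies. For the head, the old value no longer occurs in the integrand, so integrating over it
    contributes a factor 1, and Tonelli exchanges the two remaining integrals. *)
Lemma power_probability_resample (n : nat) (i : 'I_n) (f : n.-tuple T -> \bar R) :
  measurable_fun [set: _.-tuple T] f -> (forall w, 0 <= f w) ->
  \int[power_probability P n]_w f w =
  \int[power_probability P n]_w \int[P]_x f (replace i w x).
Proof.
elim: n i f => [[]//|n IH] i f mf f0.
have mF m (h : 'I_m) (k : m.-tuple T -> \bar R) :
    measurable_fun [set: _.-tuple T] k -> (forall w, 0 <= k w) ->
    measurable_fun setT (fun w => \int[P]_x k (replace h w x)).
  move=> mk k0.
  apply: (@measurable_fun_fubini_tonelli_F _ _ _ _ _ P
     (fun z => k (replace h z.1 z.2))) => //.
  exact: (measurableT_comp mk (measurable_replace h)).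
rewrite [RHS](integral_power_probabilityS (mF _ i _ mf f0)); last first.
  by move=> w; apply: integral_ge0.
rewrite (integral_power_probabilityS mf f0).
have mfc : measurable_fun setT (f \o @tuple_cons _ T n).
  exact: (measurableT_comp mf (@measurable_tuple_cons _ T n)).
have [j ->|->] := unliftP ord0 i.
- apply: eq_integral => y _.
  have mfy : measurable_fun [set: n.-tuple T] (fun w => f (tuple_cons (y, w))).
    exact: (measurableT_comp mfc (pair1_measurable y)).
  rewrite [LHS](IH j _ mfy (fun w => f0 (tuple_cons (y, w)))).
  by apply: eq_integral => w _; apply: eq_integral => x _; rewrite replace_consS.
- under [RHS]eq_integral => y _.
    under eq_integral => w _.
      under eq_integral => x _ do rewrite replace_cons0.
      over.
    over.
  rewrite integral_cst//= [X in _ * X]probability_setT mule1.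
  by rewrite (fubini_tonelli (f \o @tuple_cons _ T n))// => z; exact: f0.
Qed.

(** This replaces conditioning on all coordinates but [i]: once coordinate [i] is resampled, the
    inner integral of the indicator of the intersection is at most [r] on [A] and vanishes off
    [A]. *)
Lemma power_probability_factor (n : nat) (i : 'I_n) (A B : set (n.-tuple T))
    (r : R) : measurable A -> measurable B -> (0 <= r)%R ->
  (forall w x, A (replace i w x) <-> A w) ->
  (forall w, A w -> P [set x | B (replace i w x)] <= r%:E) ->
  power_probability P n (A `&` B) <= r%:E * power_probability P n A.
Proof.
move=> mA mB r0 Ai Br; have mAB : measurable (A `&` B) by exact: measurableI.
have intE C : measurable C ->
    power_probability P n C = \int[power_probability P n]_w (\1_C w)%:E.
  by move=> mC; rewrite integral_indic// setIT.
rewrite !intE//.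
rewrite (power_probability_resample i)//; last exact/measurable_EFinP.
rewrite -ge0_integralZl//; last exact/measurable_EFinP.
apply: ge0_le_integral => //.
- by move=> w _; apply: integral_ge0.
- apply: (@measurable_fun_fubini_tonelli_F _ _ _ _ _ P
     (fun z => (\1_(A `&` B) (replace i z.1 z.2))%:E)) => //.
  apply: (@measurableT_comp _ _ _ _ _ _ (fun w => (\1_(A `&` B) w)%:E)) => //.
    exact/measurable_EFinP.
  exact: measurable_replace.
- by apply: measurable_funeM; exact/measurable_EFinP.
move=> w _.
have mrep (C : set (n.-tuple T)) : measurable C ->
    measurable [set x | C (replace i w x)].
  move=> mC; rewrite -[X in measurable X]setTI.
  exact: (measurableT_comp (measurable_replace i) (pair1_measurable w)).
rewrite (_ : \int[P]_x _ = P [set x | (A `&` B) (replace i w x)]); last first.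
  have := integral_indic P measurableT (mrep _ mAB); rewrite setIT => <-.
  by [].
have [Aw|nAw] := pselect (A w).
  rewrite indicE mem_set// mule1; apply: le_trans (Br _ Aw).
  by apply: le_measure; rewrite ?inE; [exact: mrep|exact: mrep|move=> x []].
rewrite indicE memNset// mule0.
rewrite (_ : [set x | _] = set0) ?measure0//.
by apply/seteqP; split=> // x [/Ai].
Qed.

End resampling.

(** * Measurability of finite quantifiers *)

Lemma measurable_fun_forall (disp : measure_display) (T : measurableType disp)
    (I : finType) (p : I -> T -> bool) :
  (forall i, measurable_fun [set: T] (p i)) ->
  measurable_fun [set: T] (fun x => [forall i, p i x]).
Proof.
move=> mp.
rewrite [X in measurable_fun _ X](_ : _ = fun x => all (p ^~ x) (enum I)).
  elim: (enum I) => [|i s IH] /=; first exact: measurable_cst.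
  exact: measurable_and.
apply/funext => x; apply/forallP/allP => [h i _|h i]; first exact: h.
by apply: h; rewrite mem_enum.
Qed.

Lemma measurable_fun_exists (disp : measure_display) (T : measurableType disp)
    (I : finType) (p : I -> T -> bool) :
  (forall i, measurable_fun [set: T] (p i)) ->
  measurable_fun [set: T] (fun x => [exists i, p i x]).
Proof.
move=> mp.
rewrite [X in measurable_fun _ X](_ : _ = fun x => ~~ [forall i, ~~ p i x]).
  by apply/measurable_neg/measurable_fun_forall => i; exact: measurable_neg.
by apply/funext => x; rewrite negb_forall; apply: eq_existsb => i; rewrite negbK.
Qed.

Lemma measurable_true (disp : measure_display) (T : measurableType disp)
    (p : T -> bool) :
  measurable_fun [set: T] p -> measurable [set x | p x].
Proof.
move=> mp; rewrite -[X in measurable X]setTI.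
exact: mp measurableT [set true] _.
Qed.

(** * Covers of the data, the chosen cover, and its failure event *)

Section compression.
Context (R : realType) (disp : measure_display) (T : measurableType disp).
Context (q n : nat) (b : T -> 'rV[R]_q).
Implicit Types (I J U V S : {set 'I_n}) (w : n.-tuple T).

Definition covers I w (x : T) : bool :=
  [forall l, [exists k, (k \in I) && (b (tnth w k) 0 l <= b x 0 l)]].

(** For [I] inside [U], this says that [I] is a cover of the data indexed by [U]. *)
Definition hits U I w : bool :=
  [forall i, (i \in U) ==> covers I w (tnth w i)].

(* Smaller sets come first; ties between sets are broken arbitrarily but
   independently of the data, which is what makes [chosen_sub] hold. *)
Definition priority I : nat := (#|I| * #|{set 'I_n}| + enum_rank I)%N.

Definition chosen U I w : bool :=
  [&& I \subset U, hits U I w &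
    [forall J : {set 'I_n},
      (J \subset U) && hits U J w ==> (priority I <= priority J)%N]].

Lemma priority_card I J : (priority I <= priority J)%N -> (#|I| <= #|J|)%N.
Proof.
move=> le_IJ; rewrite leqNgt; apply/negP => lt_JI.
move: le_IJ; rewrite leqNgt => /negP; apply; rewrite /priority.
(* The rank of a set is below [#|{set 'I_n}|], so one unit of cardinality outweighs any difference
   of ranks. *)
apply: (@leq_trans (#|J|.+1 * #|{set 'I_n}|)).
  by rewrite mulSnr ltn_add2l.
by rewrite (leq_trans _ (leq_addr _ _))// leq_mul2r lt_JI orbT.
Qed.

Lemma priority_inj : injective priority.
Proof.
move=> I J eq_IJ.
have eq_card : #|I| = #|J|.
  by apply/eqP; rewrite eqn_leq !priority_card// eq_IJ.
move: eq_IJ; rewrite /priority eq_card => /addnI /val_inj; exact: enum_rank_inj.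
Qed.

Lemma covers_trans V I w x : hits V I w -> covers V w x -> covers I w x.
Proof.
move=> /forall_inP hVI /forallP cV; apply/forallP => l.
have /existsP[k /andP[kV le_kx]] := cV l.
have /forallP/(_ l)/existsP[h /andP[hI le_hk]] := hVI k kV.
by apply/existsP; exists h; rewrite hI (le_trans le_hk).
Qed.

Lemma covers_subset V U w x : V \subset U -> covers V w x -> covers U w x.
Proof.
move=> /fintype.subsetP sVU /forallP cV; apply/forallP => l.
have /existsP[k /andP[/sVU kU le_kx]] := cV l.
by apply/existsP; exists k; rewrite kU.
Qed.

(** A rival [J] that covers [V] covers [I] in particular; as [I] covers [U], transitivity makes [J]
    a rival for [U] too, where [I] has already won. *)
Lemma chosen_sub I V U w :
  I \subset V -> V \subset U -> chosen U I w -> chosen V I w.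
Proof.
move=> sIV sVU /and3P[_ /forall_inP hUI /forall_inP minI].
apply/and3P; split=> //.
  by apply/forall_inP => i /(fintype.subsetP sVU); exact: hUI.
apply/forall_inP => J /andP[sJV hVJ].
apply: minI; rewrite (fintype.subset_trans sJV)//=.
apply/forall_inP => i /hUI /(covers_subset sIV); exact: covers_trans.
Qed.

Lemma chosen_unique U I J w : chosen U I w -> chosen U J w -> I = J.
Proof.
move=> /and3P[sI hI /forall_inP minI] /and3P[sJ hJ /forall_inP minJ].
by apply/priority_inj/eqP; rewrite eqn_leq minI ?minJ ?sI ?sJ.
Qed.

Lemma chosen_exists U I w : I \subset U -> hits U I w ->
  exists2 J, chosen U J w & (#|J| <= #|I|)%N.
Proof.
move=> sIU hI; pose p J := (J \subset U) && hits U J w.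
have pI : p I by rewrite /p sIU.
case: (arg_minnP priority pI) => J /andP[sJU hJ] minJ; exists J.
  by apply/and3P; split=> //; apply/forall_inP => K; exact: minJ.
exact/priority_card/minJ.
Qed.

Lemma eq_covers I w w' x :
  {in I, tnth w =1 tnth w'} -> covers I w x = covers I w' x.
Proof.
move=> ww'; apply: eq_forallb => l; apply: eq_existsb => k.
by case: (boolP (k \in I)) => //= kI; rewrite ww'.
Qed.

Lemma eq_hits U I w w' : I \subset U ->
  {in U, tnth w =1 tnth w'} -> hits U I w = hits U I w'.
Proof.
move=> sIU ww'; apply: eq_forallb => i.
case: (boolP (i \in U)) => //= iU; rewrite ww'//; apply: eq_covers.
by move=> k kI; apply/ww'/(fintype.subsetP sIU).
Qed.

Lemma eq_chosen U I w w' :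
  {in U, tnth w =1 tnth w'} -> chosen U I w = chosen U I w'.
Proof.
move=> ww'; rewrite /chosen; case: (boolP (I \subset U)) => [sIU|_]; last by [].
rewrite !andTb.
rewrite (eq_hits sIU ww'); congr (_ && _); apply: eq_forallb => J.
by case: (boolP (J \subset U)) => //= sJU; rewrite (eq_hits sJU ww').
Qed.

Context (mb : forall l : 'I_q, measurable_fun [set: T] (fun x => b x 0 l)).

Lemma measurable_covers I :
  measurable_fun [set: n.-tuple T * T] (fun z => covers I z.1 z.2).
Proof.
apply: measurable_fun_forall => l; apply: measurable_fun_exists => k.
apply: measurable_and => //; apply: measurable_fun_ler.
  apply: (measurableT_comp (mb l)).
  apply: (@measurableT_comp _ _ _ _ _ _ (fun w : n.-tuple T => tnth w k)) => //.
  exact: measurable_tnth.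
exact: (measurableT_comp (mb l)).
Qed.

Lemma measurable_covers_tnth I i :
  measurable_fun [set: n.-tuple T] (fun w => covers I w (tnth w i)).
Proof.
apply: (measurableT_comp (measurable_covers I) (g := fun w => (w, tnth w i))).
by apply: measurable_fun_pair => //; exact: measurable_tnth.
Qed.

Lemma measurable_hits U I : measurable_fun [set: n.-tuple T] (hits U I).
Proof.
apply: measurable_fun_forall => i.
case: (i \in U) => //=; exact: measurable_covers_tnth.
Qed.

Lemma measurable_chosen U I : measurable_fun [set: n.-tuple T] (chosen U I).
Proof.
apply: measurable_and => //; apply: measurable_and; first exact: measurable_hits.
apply: measurable_fun_forall => J.
case: (_ <= _)%N.
  by under eq_fun do rewrite implybT; exact: measurable_cst.
under eq_fun do rewrite implybF.
by apply/measurable_neg/measurable_and => //; exact: measurable_hits.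
Qed.

Context (P : probability T R) (eps : R).
Local Open Scope ereal_scope.

(** The quantity W(I). It depends on the data only through the coordinates in [I], so resampling any
    other coordinate leaves it unchanged. *)
Definition miss_prob I w : \bar R := P [set x | ~~ covers I w x].

Lemma measurable_miss_prob I : measurable_fun [set: n.-tuple T] (miss_prob I).
Proof.
have mA : measurable [set z : n.-tuple T * T | ~~ covers I z.1 z.2].
  apply: measurable_true; apply: measurable_neg; exact: measurable_covers.
rewrite [X in measurable_fun _ X](_ : _ = P \o xsection
    [set z : n.-tuple T * T | ~~ covers I z.1 z.2]).
  exact: (measurable_fun_xsection P mA).
apply/funext => w; congr (P _).
by apply/seteqP; split => x; rewrite /xsection /= inE.
Qed.

Definition bad U I : set (n.-tuple T) :=
  [set w | chosen U I w /\ eps%:E < miss_prob I w].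

Lemma measurable_bad U I : measurable (bad U I).
Proof.
apply: measurableI; first exact: measurable_true (measurable_chosen U I).
rewrite -[X in measurable X]setTI.
exact: emeasurable_fun_o_infty measurableT (measurable_miss_prob I) _.
Qed.

Lemma eq_bad U I w w' : I \subset U ->
  {in U, tnth w =1 tnth w'} -> bad U I w <-> bad U I w'.
Proof.
move=> sIU ww'; rewrite /bad /= (eq_chosen _ ww') /miss_prob.
have sub : {in I, tnth w =1 tnth w'} by move=> k kI; apply/ww'/(fintype.subsetP sIU).
by under eq_set do rewrite (eq_covers _ sub).
Qed.

(** Induction on the size of [D], resampling one index [i] of [D] at a time. Since [i] lies outside
    [U], neither [bad U I] nor the covering of the other data changes, while W(I) > [eps] lets a
    fresh point be covered with probability at most [1 - eps]. *)
Lemma bad_factor U I (D : {set 'I_n}) : (eps < 1)%R ->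
  I \subset U -> D \subset ~: U ->
  power_probability P n
    (bad U I `&` [set w | [forall i, (i \in D) ==> covers I w (tnth w i)]]) <=
  ((1 - eps) ^+ #|D|)%:E * power_probability P n (bad U I).
Proof.
move=> eps1 sIU; pose cov (E : {set 'I_n}) : set (n.-tuple T) :=
  [set w | [forall i, (i \in E) ==> covers I w (tnth w i)]].
rewrite -/(cov D); have mcov E : measurable (cov E).
  apply: measurable_true; apply: measurable_fun_forall => i.
  by case: (i \in E) => //=; exact: measurable_covers_tnth.
have mbad := measurable_bad U I.
move cardD : #|D| => m; elim: m D cardD => [|m IH] D cardD dUD.
  rewrite expr0 mul1e; apply: le_measure; rewrite ?inE//.
  exact: measurableI.
have /card_gt0P[i iD] : (0 < #|D|)%N by rewrite cardD.
have iU : i \notin U by have := fintype.subsetP dUD i iD; rewrite inE.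
have cardDi : #|D :\ i| = m by move: cardD; rewrite (cardsD1 i) iD => -[].
have dUDi : D :\ i \subset ~: U by rewrite (fintype.subset_trans _ dUD)// subD1set.
have -> : bad U I `&` cov D = (bad U I `&` cov (D :\ i)) `&`
    [set w | covers I w (tnth w i)].
  apply/seteqP; split => w.
    move=> [badw /forall_inP covw]; split; last exact: covw.
    by split=> //; apply/forall_inP => k /setD1P[_]; exact: covw.
  move=> [[badw /forall_inP covw] ci]; split=> //; apply/forall_inP => k kD.
  by have [->//|ki] := eqVneq k i; apply: covw; rewrite !inE ki.
have same w x : {in ~: [set i], tnth (replace i w x) =1 tnth w}.
  by move=> k; rewrite !inE tnth_replace => /negbTE ->.
have sameU w x : {in U, tnth (replace i w x) =1 tnth w}.
  by move=> k kU; apply: same; rewrite !inE; apply: contraNneq iU => <-.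
have sameI w x : {in I, tnth (replace i w x) =1 tnth w}.
  by move=> k kI; apply/sameU/(fintype.subsetP sIU).
apply: (@le_trans _ _ ((1 - eps)%:E *
    power_probability P n (bad U I `&` cov (D :\ i)))).
  apply: (@power_probability_factor _ _ _ _ _ i).
  - exact: measurableI.
  - exact: measurable_true (measurable_covers_tnth I i).
  - by rewrite subr_ge0 ltW.
  - move=> w x; rewrite /setI /=.
    have -> : cov (D :\ i) (replace i w x) = cov (D :\ i) w.
      congr is_true; apply: eq_forallb => k; rewrite !inE.
      case: eqVneq => //= ki; rewrite (eq_covers _ (sameI w x)) same//.
      by rewrite !inE.
    by split=> -[badw covw]; split=> //; apply/(eq_bad sIU (sameU w x)).
  move=> w [[_ lt_eps] _]; rewrite [X in P X](_ : _ = ~` [set x | ~~ covers I w x]).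
    have mmiss : measurable [set x | ~~ covers I w x].
      apply: measurable_true; apply: measurable_neg.
      exact: (measurableT_comp (measurable_covers I) (pair1_measurable w)).
    rewrite probability_setC// EFinB leeB//; exact: ltW.
  apply/seteqP; split => x /=; rewrite tnth_replace eqxx (eq_covers _ (sameI w x)).
    by move=> ->.
  by move=> /negP; rewrite negbK.
rewrite exprS EFinM -muleA lee_pmul2l ?lte_fin ?subr_gt0//; exact: IH.
Qed.

End compression.

(** * Binomial inequalities and averaging over intermediate sets *)

Section combinatorics.
Local Close Scope classical_set_scope.

(** Both sides count the pairs of nested subsets of sizes [k] and [m] in an [n]-element set; in
    factorials, each is n! / (k! (m-k)! (n-m)!). *)
Lemma bin_mul_bin (n m k : nat) : (k <= m)%N -> (m <= n)%N ->
  ('C(n, m) * 'C(m, k) = 'C(n, k) * 'C(n - k, m - k))%N.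
Proof.
move=> km mn; have kn := leq_trans km mn.
have mkn : (m - k <= n - k)%N by rewrite leq_sub2r.
have nkm : (n - k - (m - k) = n - m)%N by rewrite subnBA// subnK.
move: (bin_fact km) (bin_fact mn) (bin_fact kn) (bin_fact mkn); rewrite nkm.
have : (0 < k`! * ((m - k)`! * (n - m)`!))%N by rewrite !muln_gt0 !fact_gt0.
move: 'C(n, m) 'C(m, k) 'C(n, k) 'C(n - k, m - k) k`! (m - k)`! (n - m)`!.
move=> x1 x2 x3 x4 u v y f0 <- <- + E; rewrite -{}E => E.
apply/eqP; rewrite -(eqn_pmul2r f0); apply/eqP.
by rewrite -[LHS]mulnA -[RHS]mulnA (mulnCA x4) E; congr (_ * _)%N; rewrite !mulnA.
Qed.

(** After multiplication by ['C(j, k)], both sides share the factor ['C(m, k) * 'C(n, k)], and what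
    remains is the monotonicity of ['C(_, j - k)]. It carries the size inequality from [j] down to
    smaller covers. *)
Lemma bin_mul_le (n m k j : nat) : (k <= j)%N -> (m <= n)%N ->
  ('C(m, j) * 'C(n, k) <= 'C(m, k) * 'C(n, j))%N.
Proof.
move=> kj mn; have [mj|jm] := ltnP m j; first by rewrite bin_small.
have jn := leq_trans jm mn.
rewrite -(@leq_pmul2r 'C(j, k)) ?bin_gt0//.
rewrite mulnAC bin_mul_bin// -[leqRHS]mulnA bin_mul_bin//.
rewrite -!mulnA leq_mul2l; apply/orP; right.
by rewrite [leqLHS]mulnC leq_mul2l leq_bin2l ?orbT// leq_sub2r.
Qed.

(** Adjoining [I] is injective on the subsets of [S :\: I] of size [m - #|I|]. *)
Lemma card_intermediate (T : finType) (I S : {set T}) (m : nat) :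
  I \subset S -> (#|I| <= m)%N ->
  ('C(#|S| - #|I|, m - #|I|) <=
   #|[set U : {set T} | [&& I \subset U, U \subset S & #|U| == m]]|)%N.
Proof.
move=> sIS leIm; rewrite -cardsDS// -cards_draws.
have inj : {in [set A : {set T} | (A \subset S :\: I) & (#|A| == m - #|I|)%N] &,
    injective (fun A => I :|: A)}.
  move=> A B; rewrite !inE !subsetD => /andP[/andP[_ dA] _] /andP[/andP[_ dB] _] eqAB.
  have E (C : {set T}) : [disjoint C & I]%B -> C = (I :|: C) :\: I.
    by move=> dC; rewrite finset.setDUl finset.setDv finset.set0U; apply/esym/finset.setDidPl.
  by rewrite (E A)// (E B)// eqAB.
rewrite -(card_in_imset inj); apply: subset_leq_card.
apply/fintype.subsetP => _ /imsetP[A + ->].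
rewrite !inE subsetD => /andP[/andP[sAS dAI] /eqP cardA].
rewrite finset.subsetUl finset.subUset sIS sAS /= cardsU.
by rewrite finset.setIC finset.disjoint_setI0// cards0 subn0 cardA subnKC.
Qed.

(* The weights [p S I] are compared with their averages over the m-element
   sets U between I and S; for each m these averages sum to at most 1. *)
Lemma sum_small_weights (R : realFieldType) (T : finType)
    (p : {set T} -> {set T} -> R) (S : {set T}) (j M : nat) (r c : R) :
  0 < r -> 0 <= c -> (j <= #|S|)%N -> (M < #|S|)%N ->
  (forall U I, 0 <= p U I) -> (forall U, \sum_I p U I <= 1) ->
  (forall I : {set T}, ~~ (I \subset S) -> p S I = 0) ->
  (forall U I : {set T}, I \subset U -> U \subset S ->
     r ^+ #|U| * p S I <= r ^+ #|S| * p U I) ->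
  'C(#|S|, j)%:R * r ^+ #|S| <= c * \sum_(m < M.+1) 'C(m, j)%:R * r ^+ m ->
  \sum_(I : {set T} | (#|I| <= j)%N) p S I <= c * M.+1%:R.
Proof.
move=> r0 c0 jS MS p0 p1 pS0 pr hc.
have rX m : 0 <= r ^+ m by rewrite exprn_ge0// ltW.
pose D m := [set U : {set T} | (U \subset S) && (#|U| == m)].
have cardD m : #|D m| = 'C(#|S|, m).
  by rewrite -cards_draws; apply: eq_card => U; rewrite !inE.
pose a m I := 'C(#|S|, m)%:R^-1 * \sum_(U in D m) p U I.
have a0 m I : 0 <= a m I by rewrite mulr_ge0 ?invr_ge0// sumr_ge0.
have binS m : (m <= #|S|)%N -> 0 < 'C(#|S|, m)%:R :> R.
  by move=> mS; rewrite ltr0n bin_gt0.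
(* Sum the comparison of [p S I] with [p U I] over the sets [U] of size [m] between [I] and [S];
   [bin_mul_bin] turns their number into the two binomials displayed here. *)
have le_a (m : 'I_M.+1) (I : {set T}) : I \subset S ->
    'C(m, #|I|)%:R * r ^+ m * p S I <= 'C(#|S|, #|I|)%:R * r ^+ #|S| * a m I.
  move=> sIS; have mS : (m <= #|S|)%N by rewrite (leq_trans _ MS)// ltnW.
  have [mI|Im] := ltnP m #|I|.
    by rewrite bin_small// !mul0r mulr_ge0// mulr_ge0.
  rewrite /a mulrCA ler_pdivlMl ?binS// !mulrA -natrM.
  rewrite bin_mul_bin// natrM -!mulrA ler_pM2l ?binS ?subset_leq_card//.
  rewrite mulr_sumr.
  pose E := [set U : {set T} | [&& I \subset U, U \subset S & #|U| == m]].
  apply: (@le_trans _ _ (\sum_(U in E) r ^+ #|S| * p U I)); last first.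
    rewrite [leRHS]big_mkcond [leLHS]big_mkcond /=; apply: ler_sum => U _.
    rewrite !inE; case: (I \subset U) => //=; case: ifP => // _.
    by rewrite mulr_ge0.
  apply: (@le_trans _ _ (\sum_(U in E) r ^+ m * p S I)); last first.
    by apply: ler_sum => U; rewrite !inE => /and3P[IU US /eqP <-]; exact: pr.
  rewrite sumr_const -[leRHS]mulr_natl ler_wpM2r ?mulr_ge0//.
  by rewrite ler_nat; exact: card_intermediate.
have le_pS (I : {set T}) : (#|I| <= j)%N -> p S I <= c * \sum_(m < M.+1) a m I.
  move=> Ij; have [sIS|/pS0->] := boolP (I \subset S); last first.
    by rewrite mulr_ge0// sumr_ge0.
  have IS := subset_leq_card sIS.
  have k0 : 0 < 'C(#|S|, #|I|)%:R * r ^+ #|S| by rewrite mulr_gt0 ?binS ?exprn_gt0.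
  rewrite -(ler_pM2l k0).
  (* The hypothesis concerns [j] only; [bin_mul_le] yields its analogue for every cardinality up to
     [j]. *)
  have hk : 'C(#|S|, #|I|)%:R * r ^+ #|S| <=
      c * \sum_(m < M.+1) 'C(m, #|I|)%:R * r ^+ m.
    rewrite -(ler_pM2l (binS _ jS)) mulrCA.
    apply: (le_trans (ler_wpM2l (ler0n _ _) hc)).
    rewrite mulrCA [leRHS]mulrCA ler_wpM2l// !mulr_sumr; apply: ler_sum => m _.
    rewrite !mulrA ler_wpM2r// -!natrM ler_nat.
    rewrite mulnC [leqRHS]mulnC; apply: bin_mul_le => //.
    by rewrite (leq_trans _ MS)// ltnW.
  apply: (le_trans (ler_wpM2r (p0 _ _) hk)).
  rewrite mulrCA -mulrA ler_wpM2l// mulr_suml mulr_sumr.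
  by apply: ler_sum => m _; exact: le_a.
apply: (@le_trans _ _ (\sum_I c * \sum_(m < M.+1) a m I)).
  rewrite [leLHS]big_mkcond; apply: ler_sum => I _.
  by case: ifP => [/le_pS//|_]; rewrite mulr_ge0// sumr_ge0.
rewrite -mulr_sumr ler_wpM2l// exchange_big /=.
rewrite -[M.+1 in leRHS]card_ord -sumr_const; apply: ler_sum => m _.
have mS : (m <= #|S|)%N by rewrite (leq_trans _ MS)// ltnW.
rewrite -mulr_sumr ler_pdivrMl ?binS// mulr1 exchange_big /= -cardD -sumr_const.
by apply: ler_sum => U _; exact: p1.
Qed.

End combinatorics.

(** * Finite union bound and disjoint events *)

Section finite_unions.
Context (disp : measure_display) (T : measurableType disp) (R : realType).
Local Open Scope ereal_scope.

Lemma measure_le_sum (mu : {measure set T -> \bar R}) (I : finType)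
    (p : pred I) (A : set T) (F : I -> set T) :
  measurable A -> (forall i, measurable (F i)) ->
  (forall w, A w -> exists2 i, p i & F i w) ->
  mu A <= \sum_(i | p i) mu (F i).
Proof.
move=> mA mF AF; pose G := \big[setU/set0]_(i | p i) F i.
have mG : measurable G by exact: bigsetU_measurable.
apply: (@le_trans _ _ (mu G)).
  apply: le_measure; rewrite ?inE// => w /AF[i pi Fi].
  by rewrite /G (bigD1 i)//=; left.
have : measurable G /\ mu G <= \sum_(i | p i) mu (F i).
  rewrite /G; elim/big_rec2: _ => [|i s X pi [mX leX]].
    by rewrite measure0; split.
  split; first exact: measurableU.
  by rewrite (le_trans (measureU2 _ _ _))// leeD2l.
by case.
Qed.

Lemma sum_disjoint_probability (P : probability T R) (I : finType)
    (F : I -> set T) :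
  (forall i, measurable (F i)) ->
  (forall i j w, F i w -> F j w -> i = j) ->
  \sum_i P (F i) <= 1.
Proof.
move=> mF dF; have setTE : [set: I] = [set` enum I].
  by apply/seteqP; split=> // i _ /=; rewrite mem_enum.
have tF : trivIset [set: I] F.
  by move=> i j _ _ [w [Fi Fj]]; exact: dF Fi Fj.
have := measure_fin_bigcup P (finite_finset : finite_set [set: I]) tF (fun i _ => mF i).
rewrite setTE -fsbig_seq ?enum_uniq// big_enum /= => <-.
by apply: probability_le1; apply: fin_bigcup_measurable; first exact: finite_finset.
Qed.

End finite_unions.

(** * Geometric decay against binomials, and existence of the sizes *)

Lemma bin_geometric_le (R : archiRealFieldType) (r e : R) (j : nat) :
  0 < r < 1 -> 0 < e ->
  exists N0, forall N, (N0 <= N)%N -> 'C(N, j)%:R * r ^+ N <= e.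
Proof.
move=> /andP[r0 r1] e0; pose a := r^-1 - 1.
have a0 : 0 < a by rewrite subr_gt0 invf_gt1.
have aX : 0 < a ^+ j.+1 by exact: exprn_gt0.
have d0 : 0 < e * a ^+ j.+1 by exact: mulr_gt0.
(* The final estimate amounts to [x <= N - j]. In the witness below, [j.+1] secures [j < N] and
   [Num.bound x] supplies the rest. *)
pose x := j.+1%:R / (e * a ^+ j.+1).
have x0 : 0 <= x by rewrite divr_ge0// ltW.
exists (j.+1 + Num.bound x)%N => N leN.
have jN : (j < N)%N by rewrite (leq_trans _ leN)// leq_addr.
(* One term of the expansion of (1 + a)^N = r^(-N). Passing from ['C(N, j.+1)] to ['C(N, j)] then
   gains a factor of order 1 / (N - j). *)
have binom : 'C(N, j.+1)%:R * a ^+ j.+1 * r ^+ N <= 1.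
  rewrite -ler_pdivlMr ?exprn_gt0// mul1r -exprVn.
  rewrite (_ : r^-1 = 1 + a); last by rewrite addrC subrK.
  rewrite [leRHS]GRing.exprDn (bigD1 (inord j.+1))//= inordK//.
  rewrite expr1n mul1r mulr_natl lerDl; apply: sumr_ge0 => i _.
  by rewrite mulrn_wge0// expr1n mul1r exprn_ge0// ltW.
have Nj0 : 0 < (N - j)%:R :> R by rewrite ltr0n subn_gt0.
have le_x : x <= (N - j)%:R.
  apply: (@le_trans _ _ (Num.bound x)%:R); first exact/ltW/archi_boundP.
  rewrite ler_nat leq_subRL; last exact: ltnW.
  by apply: leq_trans leN; rewrite leq_add2r leqnSn.
have key : (N - j)%:R * (a ^+ j.+1 * ('C(N, j)%:R * r ^+ N)) <= j.+1%:R.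
  have -> : (N - j)%:R * (a ^+ j.+1 * ('C(N, j)%:R * r ^+ N)) =
      (N - j)%:R * 'C(N, j)%:R * (a ^+ j.+1 * r ^+ N) by ring.
  rewrite -natrM -mul_bin_left natrM.
  rewrite -mulrA ler_piMr// (le_trans _ binom)// le_eqVlt; apply/orP; left.
  by apply/eqP; ring.
rewrite -(ler_pM2l (mulr_gt0 Nj0 aX)) -mulrA (le_trans key)//.
by move: le_x; rewrite ler_pdivrMr// => /le_trans; apply; rewrite -mulrA (mulrC e).
Qed.

Lemma bin_geometric_le_all (R : archiRealFieldType) (r e : R) (j : nat) :
  0 < r < 1 -> 0 < e ->
  exists N0, forall N m, (N0 <= N)%N -> (m < j)%N -> 'C(N, m)%:R * r ^+ N <= e.
Proof.
move=> r01 e0; elim: j => [|j [N0 h0]]; first by exists 0%N.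
have [N1 h1] := bin_geometric_le j r01 e0.
exists (maxn N0 N1) => N m; rewrite geq_max => /andP[le0 le1].
by rewrite ltnS leq_eqVlt => /orP[/eqP->|]; [exact: h1|exact: h0].
Qed.

Section sizes_spec.
Context (R : realType) (eps beta : R) (q : nat).
Hypotheses (eps01 : 0 < eps < 1) (beta0 : 0 < beta).

Lemma Mbar_ge (j : nat) : (maxn j 1 <= Mbar eps beta j)%N.
Proof.
have /andP[e0 e1] := eps01; pose k := maxn j 1; pose r := 1 - eps.
have r01 : 0 < r < 1 by rewrite subr_gt0 e1 gtrBl e0.
have [r0 r1] := andP r01.
have k0 : (0 < k)%N by rewrite leq_max orbT.
(* Each of the [k] summands gets the share [beta / k]; the factor [r ^+ k] pays for replacing
   [r ^+ M] by [r ^+ (M - m)] with [m < k]. *)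
have d0 : 0 < beta * r ^+ k / k%:R by rewrite divr_gt0 ?mulr_gt0 ?exprn_gt0 ?ltr0n.
have [N0 hN] := bin_geometric_le_all k r01 d0.
have ne : [set M : nat | (k <= M)%N /\
    \sum_(0 <= m < k) 'C(M, m)%:R * eps ^+ m * (1 - eps) ^+ (M - m) <= beta]
    !=set0.
  exists (maxn k N0); rewrite /= leq_maxl; split=> //.
  have kM : (k <= maxn k N0)%N by rewrite leq_maxl.
  move: (maxn k N0) kM (leq_maxr k N0) => M kM N0M.
  apply: (@le_trans _ _ (\sum_(0 <= m < k) beta / k%:R)).
    rewrite !big_mkord; apply: ler_sum => m _.
    have mM : (m <= M)%N by rewrite (leq_trans _ kM)// ltnW.
    have eX : eps ^+ m <= 1 by rewrite exprn_ile1// ltW.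
    apply: (@le_trans _ _ ('C(M, m)%:R * r ^+ (M - m))).
      by rewrite ler_wpM2r// ?ler_piMr// exprn_ge0// ltW.
    rewrite -(ler_pM2r (exprn_gt0 m r0)) -mulrA -exprD subnK//.
    apply: (le_trans (hN M m N0M (ltn_ord m))).
    rewrite -mulrA mulrCA mulrC ler_pM2l ?divr_gt0 ?ltr0n//.
    by apply: ler_wiXn2l; rewrite ?(ltW r0) ?(ltW r1)// ltnW.
  by rewrite big_const_nat subn0 iter_addr_0 -[leLHS]mulr_natr divfK// pnatr_eq0 -lt0n.
by have [[]] := leastP ne.
Qed.

(** The defining inequality is multiplied by [(1 - eps) ^+ j], which removes the shifts in the
    exponents; the terms with [m < j] may be added because their binomials vanish. *)
Lemma size_atP (j : nat) : (Mbar eps beta j < size_at eps beta q j)%N /\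
  'C(size_at eps beta q j, j)%:R * (1 - eps) ^+ size_at eps beta q j <=
  beta_at eps beta q j *
    \sum_(m < (Mbar eps beta j).+1) 'C(m, j)%:R * (1 - eps) ^+ m.
Proof.
have /andP[e0 e1] := eps01; pose r := 1 - eps.
have r01 : 0 < r < 1 by rewrite subr_gt0 e1 gtrBl e0.
have [r0 r1] := andP r01.
have jM : (j <= Mbar eps beta j)%N.
  by rewrite (leq_trans _ (Mbar_ge j))// leq_maxl.
move: (Mbar_ge j); rewrite /size_at /beta_at; set M := Mbar eps beta j => _.
set c := beta / _; have c0 : 0 < c by rewrite divr_gt0// mulr_gt0 ?ltr0n.
set s := (\sum_(j <= m < _) _).
(* The term [m = j] equals 1, and it is present because [j <= M]. *)
have s0 : 0 < s.
  rewrite /s big_ltn ?ltnS// binn mul1r subnn expr0 ltr_wpDr// sumr_ge0// => m _.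
  by rewrite mulr_ge0// exprn_ge0// ltW.
have [N0 hN] := bin_geometric_le j r01 (mulr_gt0 (mulr_gt0 c0 s0) (exprn_gt0 j r0)).
set A := (X in least X); have ne : A !=set0.
  exists (maxn M.+1 N0); rewrite /A /= leq_maxl; split=> //.
  rewrite -(ler_pM2r (exprn_gt0 j r0)) -mulrA -exprD subnK.
    by apply: hN; rewrite leq_maxr.
  by rewrite (leq_trans (leqW jM))// leq_maxl.
have [[MN hA] _] := leastP ne; split=> //.
move: (least A) MN hA => N MN.
rewrite -(ler_pM2r (exprn_gt0 j r0)) -mulrA -exprD subnK; last first.
  by rewrite (leq_trans jM)// ltnW.
move=> /le_trans; apply; rewrite -mulrA ler_wpM2l ?(ltW c0)// /s mulr_suml.
pose F m := 'C(m, j)%:R * r ^+ m.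
have -> : \sum_(m < M.+1) 'C(m, j)%:R * (1 - eps) ^+ m = \sum_(0 <= m < M.+1) F m.
  by rewrite big_mkord.
have jM1 : (j <= M.+1)%N by exact: leqW.
rewrite [leRHS](big_cat_nat (leq0n j) jM1) /=.
rewrite [X in _ <= X + _]big_nat_cond [X in _ <= X + _]big1 ?add0r; last first.
  by move=> m /andP[/andP[_ mj] _]; rewrite /F bin_small// mul0r.
rewrite [leLHS]big_nat_cond [leRHS]big_nat_cond.
apply: ler_sum => m /andP[/andP[jm _] _].
by rewrite -mulrA -exprD subnK.
Qed.

End sizes_spec.

(** * From a risky output to a bad chosen cover *)

Section risk_bound.
Context (R : realType) (disp : measure_display) (T : measurableType disp).
Context (q : nat) (b : T -> 'rV[R]_q).
Context (mb : forall l : 'I_q, measurable_fun [set: T] (fun x => b x 0 l)).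
Context (P : probability T R) (eps : R).

Lemma sum_bad_le (n : nat) (S : {set 'I_n}) (j M : nat) (c : R) :
  0 < eps < 1 -> 0 <= c -> (j <= M)%N -> (M < #|S|)%N ->
  'C(#|S|, j)%:R * (1 - eps) ^+ #|S| <=
    c * \sum_(m < M.+1) 'C(m, j)%:R * (1 - eps) ^+ m ->
  (\sum_(I : {set 'I_n} | (#|I| <= j)%N)
    power_probability P n (bad b P eps S I) <= (c * M.+1%:R)%:E)%E.
Proof.
move=> /andP[e0 e1] c0 jM MS hc.
pose p (U I : {set 'I_n}) := fine (power_probability P n (bad b P eps U I)).
have mbad (U I : {set 'I_n}) : measurable (bad b P eps U I).
  exact: measurable_bad.
have pE (U I : {set 'I_n}) :
    power_probability P n (bad b P eps U I) = (p U I)%:E.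
  by rewrite fineK// fin_num_measure.
rewrite (eq_bigr (fun I => (p S I)%:E)) => [|I _]; last exact: pE.
rewrite sumEFin lee_fin.
apply: (@sum_small_weights _ _ p S j M (1 - eps)) => //.
- by rewrite subr_gt0.
- by rewrite (leq_trans jM)// ltnW.
- by move=> U I; rewrite fine_ge0.
- move=> U; rewrite -lee_fin -sumEFin.
  rewrite (eq_bigr (fun I => power_probability P n (bad b P eps U I))) => [|I _].
    apply: sum_disjoint_probability => [I|I J w [cI _] [cJ _]]; first exact: mbad.
    exact: chosen_unique cI cJ.
  by rewrite pE.
- move=> I nIS; rewrite /p (_ : bad _ _ _ _ _ = set0) ?measure0//.
  by apply/seteqP; split=> // w [/and3P[sIS]]; rewrite sIS in nIS.
- move=> U I sIU sUS.
  (* If [I] is chosen for [S], it is chosen for [U] and also covers the data in [S :\: U], so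
     [bad_factor] applies with that difference as [D]. *)
  have le_fac : p S I <= (1 - eps) ^+ #|S :\: U| * p U I.
    rewrite -lee_fin EFinM -!pE.
    apply: le_trans (bad_factor mb P e1 sIU (D := S :\: U) _); last first.
      by rewrite finset.setDE finset.subsetIr.
    apply: le_measure; rewrite ?inE//.
      apply: measurableI => //; apply: measurable_true.
      apply: measurable_fun_forall => i; case: (i \in _) => //=.
      exact: measurable_covers_tnth.
    move=> w [cS lt_eps]; split; first by split=> //; exact: chosen_sub cS.
    apply/forall_inP => i /setDP[iS _]; have /and3P[_ /forall_inP + _] := cS.
    exact.
  have -> : #|S| = (#|U| + #|S :\: U|)%N.
    by rewrite cardsDS// subnKC// subset_leq_card.
  by rewrite exprD -mulrA ler_wpM2l// exprn_ge0// subr_ge0 ltW.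
Qed.

Context (d : nat) (X : set 'rV[R]_d) (f : 'rV[R]_d -> R).
Context (g : 'rV[R]_d -> 'rV[R]_q).
Context (sel : seq T -> 'I_q -> nat) (hsel : argmin_rule b sel).

Lemma nth_component_values (n m : nat) (w : n.-tuple T) (l : 'I_q) (k : 'I_n) :
  (k < m)%N -> (component_values b l (take m w))`_k = b (tnth w k) 0 l.
Proof.
move=> km; rewrite (nth_map (tnth w k)); first by rewrite nth_take// -tnth_nth.
by rewrite size_take_min size_tuple leq_min km ltn_ord.
Qed.

(** Every selected index points into the data, so the reduced constraints are among those of the
    full scenario problem. *)
Lemma feasible_reduced (n m : nat) (w : n.-tuple T) (x : 'rV[R]_d) :
  (0 < m <= n)%N -> feasible (scenario_problem X f g b w) x ->
  feasible (reduced_problem X f g b sel (take m w)) x.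
Proof.
move=> /andP[m0 mn] [Xx /allP gw]; split=> // l.
have sz : size (take m w) = m by rewrite size_takel// size_tuple.
have /(_ l)[] := hsel (s := take m w); first by rewrite sz.
rewrite sz => lt_sel _; have lt_n := leq_trans lt_sel mn.
rewrite -[sel _ l]/(val (Ordinal lt_n)) nth_component_values//.
by have /forallP := gw _ (mem_tnth (Ordinal lt_n) w).
Qed.

(** The selected indices form a cover of the first [m] data, so the chosen cover has at most [j]
    elements as well. A scenario covered by the latter cannot be violated by [x], whence the risk is
    at most W of the chosen cover. *)
Lemma risk_bad (n m j : nat) (w : n.-tuple T) (x : 'rV[R]_d) :
  (0 < m <= n)%N -> (num_selected sel (take m w) <= j)%N ->
  feasible (reduced_problem X f g b sel (take m w)) x ->
  (eps%:E < risk g b P x)%E ->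
  exists2 I : {set 'I_n}, (#|I| <= j)%N &
    bad b P eps [set i : 'I_n | (i < m)%N]%SET I w.
Proof.
move=> /andP[m0 mn] sel_j [_ gx] lt_eps; set s := take m w in sel_j gx.
set S := [set i : 'I_n | (i < m)%N]%SET.
have sz : size s = m by rewrite size_takel// size_tuple.
have selP l : (sel s l < m)%N /\ forall k, (k < m)%N ->
    (component_values b l s)`_(sel s l) <= (component_values b l s)`_k.
  by have := hsel (s := s); rewrite sz => /(_ l m0).
pose idx l : 'I_n := Ordinal (leq_trans (selP l).1 mn).
pose I0 : {set 'I_n} := [set idx l | l : 'I_q]%SET.
have cardI0 : (#|I0| <= j)%N.
  apply: leq_trans sel_j; rewrite cardE -(size_map val); apply: uniq_leq_size.
    by rewrite map_inj_uniq ?enum_uniq//; exact: val_inj.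
  move=> _ /mapP[i + ->]; rewrite mem_enum => /imsetP[l _ ->] /=.
  by rewrite mem_undup; apply: map_f; rewrite mem_enum.
have sI0S : I0 \subset S.
  by apply/fintype.subsetP => _ /imsetP[l _ ->]; rewrite inE; exact: (selP l).1.
have hI0 : hits b S I0 w.
  apply/forall_inP => i; rewrite inE => im; apply/forallP => l.
  apply/existsP; exists (idx l); rewrite imset_f//=.
  have := (selP l).2 i im.
  rewrite -[sel s l]/(val (idx l)) !nth_component_values//; exact: (selP l).1.
have [J cJ leJ] := chosen_exists sI0S hI0; exists J; first exact: leq_trans cardI0.
split=> //; apply: (lt_le_trans lt_eps); apply: le_measure; rewrite ?inE.
- apply: measurable_true; apply: measurable_neg; apply: measurable_fun_forall => l.
  by apply: measurable_fun_ler => //; exact: mb.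
- apply: measurable_true; apply: measurable_neg.
  exact: (measurableT_comp (measurable_covers mb J) (pair1_measurable w)).
move=> delta /=; apply: contra => /forallP cov; apply/forallP => l.
have /existsP[k /andP[kJ le_k]] := cov l.
have /and3P[/fintype.subsetP sJS _ _] := cJ.
have km : (k < m)%N by have := sJS k kJ; rewrite inE.
(* The bound on [g x] is the minimum of [b] over the first [m] data, which is at most the value at
   the index [k] of [J]. *)
apply: le_trans le_k; apply: (le_trans (gx l)).
by rewrite -(nth_component_values w l km); exact: (selP l).2.
Qed.

Lemma stopping_stageP (N : nat -> nat) (w : seq T) :
  (stopping_stage sel N w <= q)%N /\
  (num_selected sel (take (N (stopping_stage sel N w)) w) <=
   stopping_stage sel N w)%N.
Proof.
rewrite /stopping_stage; set p := (fun j => _ <= j)%N.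
have hasp : has p (iota 0 q.+1).
  apply/hasP; exists q; first by rewrite mem_iota add0n /=.
  by rewrite /p (leq_trans (size_undup _))// size_map size_enum_ord.
have := hasp; rewrite has_find size_iota ltnS => le_q; split=> //.
by have := nth_find 0%N hasp; rewrite nth_iota ?add0n.
Qed.

End risk_bound.

(** * Union bound over the stages *)

Theorem theorem4 (R : realType) (disp : measure_display)
  (Delta : measurableType disp) (d q : nat) (hq : (1 <= q)%N)
  (X : set 'rV[R]_d) (f : 'rV[R]_d -> R)
  (g : 'rV[R]_d -> 'rV[R]_q) (b : Delta -> 'rV[R]_q)
  (mb : forall l : 'I_q, measurable_fun [set: Delta] (fun delta => b delta 0 l))
  (eps beta : R) (heps : 0 < eps < 1) (hbeta : 0 < beta < 1)
  (P : probability Delta R)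
  (hfeas : forall N : nat, {ae power_probability P N, forall w : N.-tuple Delta,
     feasible (scenario_problem X f g b w) !=set0})
  (sel : seq Delta -> 'I_q -> nat) (hsel : argmin_rule b sel)
  (xstar : (num_scenarios eps beta q).-tuple Delta -> 'rV[R]_d)
  (hxstar : forall w : (num_scenarios eps beta q).-tuple Delta,
     feasible (final_problem X f g b sel (size_at eps beta q) w) !=set0 ->
     feasible (final_problem X f g b sel (size_at eps beta q) w) (xstar w))
  (mxstar : measurable [set w | (risk g b P (xstar w) <= eps%:E)%E]) :
  ((1 - beta)%:E <=
   power_probability P (num_scenarios eps beta q)
     [set w | (risk g b P (xstar w) <= eps%:E)%E])%E.
Proof.
have /andP[e0 e1] := heps; have /andP[b0 b1] := hbeta.
set n := num_scenarios eps beta q in xstar hxstar mxstar *.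
pose N := size_at eps beta q.
pose S j : {set 'I_n} := [set i : 'I_n | (i < N j)%N]%SET.
have N_gt0 j : (0 < N j)%N.
  by have [+ _] := size_atP q heps b0 j; exact: leq_trans.
(* [n] is the maximum of all the sizes, so it bounds each [N j] even where the sizes fail to
   increase with [j]. *)
have N_le j : (j <= q)%N -> (N j <= n)%N.
  by rewrite -ltnS => jq; exact: (leq_bigmax (Ordinal jq)).
have cardS j : (j <= q)%N -> #|S j| = N j.
  move=> jq; rewrite cardsE -sum1_card.
  rewrite -(big_ord_widen _ (fun=> 1%N) (N_le _ jq)).
  by rewrite sum1_card card_ord.
have [Z [mZ PZ0 infeasZ]] := hfeas n.
pose G := [set w | (risk g b P (xstar w) <= eps%:E)%E].
(* Indexing by pairs of a fixed stage and a cover removes the random stopping stage: failures at all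
   stages are counted. *)
pose B (p : 'I_q.+1 * {set 'I_n}) := bad b P eps (S p.1) p.2.
have mB p : measurable (B p) by exact: measurable_bad.
have bad_cover w : (~` G `\` Z) w ->
    exists2 p : 'I_q.+1 * {set 'I_n}, (#|p.2| <= p.1)%N & B p w.
  move=> [/negP nGw nZw]; move: nGw; rewrite -ltNge => risk_w.
  have [x feas_x] : feasible (scenario_problem X f g b w) !=set0.
    by apply: contrapT => infeas; apply/nZw/infeasZ.
  have [le_q sel_le] := stopping_stageP sel N w.
  have N_ok : (0 < N (stopping_stage sel N w) <= n)%N by rewrite N_gt0 N_le.
  have feas_w : feasible (final_problem X f g b sel N w) (xstar w).
    by apply: hxstar; exists x; exact: (feasible_reduced hsel N_ok feas_x).
  have [I leI badI] := risk_bad mb hsel N_ok sel_le feas_w risk_w.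
  by exists (Ordinal (le_q : (_ < q.+1)%N), I).
have stage_le (j : 'I_q.+1) : (\sum_(I : {set 'I_n} | (#|I| <= j)%N)
    power_probability P n (bad b P eps (S j) I) <= (beta / q.+1%:R)%:E)%E.
  have jq : (j <= q)%N by rewrite -ltnS.
  have [MN hc] := size_atP q heps b0 j.
  have jM : (j <= Mbar eps beta j)%N.
    by apply: leq_trans (Mbar_ge heps b0 j); exact: leq_maxl.
  (* The factor [(Mbar j).+1] in the denominator of [beta_at] offsets the number of set sizes
     averaged over. *)
  have -> : beta / q.+1%:R = beta_at eps beta q j * (Mbar eps beta j).+1%:R.
    by rewrite /beta_at invfM mulrA divfK// pnatr_eq0.
  apply: sum_bad_le => //; rewrite ?cardS//.
  by rewrite divr_ge0 ?(ltW b0)// mulr_ge0.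
have mGc : measurable (~` G) by exact: measurableC.
have PGc : (power_probability P n (~` G) <= beta%:E)%E.
  (* [Z] is the null set outside which the problem with all [n] scenarios is feasible, so that
     [hxstar] applies. *)
  apply: (@le_trans _ _ (power_probability P n ((~` G `\` Z) `|` Z))).
    apply: le_measure; rewrite ?inE//.
      by apply: measurableU => //; exact: measurableD.
    by move=> w nGw; have [|] := pselect (Z w); [right|left].
  rewrite (measureU0 _ mZ PZ0); last first.
    exact: measurableD.
  apply: (le_trans (measure_le_sum _ _ mB bad_cover)); first exact: measurableD.
  rewrite -(pair_big_dep xpredT (fun (j : 'I_q.+1) (I : {set 'I_n}) => (#|I| <= j)%N)
    (fun j I => power_probability P n (B (j, I)))) /=.
  apply: (@le_trans _ _ (\sum_(j < q.+1) (beta / q.+1%:R)%:E)%E).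
    by apply: lee_sum => j _; exact: stage_le.
  by rewrite sumEFin sumr_const card_ord -[X in X%:E]mulr_natr divfK// pnatr_eq0.
by rewrite -/G -[G]setCK probability_setC// EFinB leeB.
Qed.
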